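(* Let $p\in[1,\infty)$. The dual space of $\Lambda_p(\mathbb{R}^d)$ is trivial, that is, $\Lambda_p(\mathbb{R}^d)^*=\{0\}$.
   Context: $\mathbb{R}^d$ is endowed with the Borel $\sigma$-algebra and the Lebesgue measure, denoted $|\cdot|$. $\Lambda_p(\mathbb{R}^d)$ is the vector space of real-valued measurable functions $f$ on $\mathbb{R}^d$ (identified a.e.) such that for every $\delta>0$ there exists a measurable set $E_\delta$ with $|E_\delta|<\delta$ and $f\chi_{E_\delta^c}\in L_p(\mathbb{R}^d)$. It carries the topology induced by the metric $(f,g)\mapsto\|f-g\|_{\alpha_p}$, where $\|f\|_{\alpha_p}=\|\min(|f|,1)\|_p$ and $\|\cdot\|_p$ is the $L_p$ norm. $\Lambda_p(\mathbb{R}^d)^*$ denotes the space of all continuous linear functionals $\Lambda_p(\mathbb{R}^d)\to\mathbb{R}$. *)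

(* Defs.v *)
From HB Require Import structures.
From mathcomp Require Import all_boot all_order all_algebra.
From mathcomp Require Import generic_quotient ring_quotient.
From mathcomp Require Import all_classical all_reals all_analysis.
From mathcomp Require Import measurable_realfun.
Set Implicit Arguments.
Unset Strict Implicit.
Unset Printing Implicit Defensive.
Import Order.TTheory GRing.Theory Num.Def Num.Theory.
Import numFieldTopology.Exports numFieldNormedType.Exports.
Local Open Scope classical_set_scope.
Local Open Scope ring_scope.

Section alpha_norm.
Context d (T : measurableType d) (R : realType).
Variables (mu : {measure set T -> \bar R}) (p : R).
Local Open Scope ereal_scope.
Implicit Types f g : T -> R.

Definition in_Lambda f := measurable_fun [set: T] f /\
  forall delta : R, (0 < delta)%R -> exists E : set T,
    [/\ measurable E, mu E < delta%:E &
        (fun x => f x * \1_(~` E) x)%R \in Lfun mu p%:E].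

Definition alpha_norm f : \bar R :=
  Lnorm mu p%:E (fun x => (minr `|f x| 1)%:E).

Variable p1 : (1 <= p)%R.

Let p0 : (0 < p)%R. Proof. exact: lt_le_trans ltr01 p1. Qed.

Lemma le_Lnorm f g : measurable_fun setT f -> measurable_fun setT g ->
  (forall x, `|f x| <= `|g x|)%R ->
  Lnorm mu p%:E (EFin \o f) <= Lnorm mu p%:E (EFin \o g).
Proof.
move=> mf mg fg; rewrite unlock /Lnorm.
have pV : (0 <= p^-1)%R by rewrite invr_ge0 ltW.
have i0 (h : T -> R) : 0 <= \int[mu]_x (`| (EFin \o h) x | `^ p).
  by apply: integral_ge0 => x _; exact: poweR_ge0.
have mm (h : T -> R) : measurable_fun setT h ->
    measurable_fun setT (fun x => `| (EFin \o h) x | `^ p).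
  move=> mh; apply: (measurableT_comp (measurable_poweR _)).
  by apply: measurableT_comp => //; exact/measurable_EFinP.
apply: (gt0_ler_poweR pV); try by rewrite in_itv/= i0 leey.
apply: ge0_le_integral => //.
- by move=> x _; exact: poweR_ge0.
- exact: mm.
- exact: mm.
move=> x _; apply: (gt0_ler_poweR (ltW p0));
  try by rewrite in_itv/= ?lee_fin ?normr_ge0 leey.
by rewrite /= lee_fin.
Qed.

Lemma Lfun_le f g : measurable_fun setT f -> g \in Lfun mu p%:E ->
  (forall x, `|f x| <= `|g x|)%R -> f \in Lfun mu p%:E.
Proof.
move=> mf /andP[]; rewrite !inE/= => mg ng fg.
apply/andP; rewrite !inE/=; split => //.
exact: le_lt_trans (le_Lnorm mf mg fg) ng.
Qed.

Let p1E : 1 <= p%:E. Proof. by rewrite lee_fin. Qed.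

Let mrestr f E : measurable_fun setT f -> measurable E ->
  measurable_fun setT (fun x => f x * \1_(~` E) x)%R.
Proof.
move=> mf mE; apply: measurable_funM => //.
exact/measurable_indicP/measurableC.
Qed.

Let restr_le f (A B : set T) : A `<=` B ->
  forall x, (`|f x * \1_A x| <= `|f x * \1_B x|)%R.
Proof.
move=> AB x; rewrite !normrM ler_wpM2l// !indicE.
have [xA|] := boolP (x \in A); last by rewrite normr0.
by have /mem_set -> : B x by apply: AB; exact: set_mem.
Qed.

Lemma in_Lambda_submod_closed :
  in_Lambda (cst 0%R) /\
  forall (a : R) f g, in_Lambda f -> in_Lambda g ->
    in_Lambda (fun x => a * f x + g x)%R.
Proof.
have [L0 LD] := Lfun_submod_closed mu p1E.
split.
  split; first exact: measurable_cst.
  move=> delta d0; exists set0; split=> //; first by rewrite measure0 lte_fin.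
  rewrite (_ : (fun _ => _) = 0%R)//.
  by apply/funext => x; rewrite mul0r.
move=> a f g [mf Lf] [mg Lg]; split.
  by apply: measurable_funD => //; exact: measurable_funM.
move=> delta d0; have d20 : (0 < delta / 2)%R by rewrite divr_gt0.
have [E [mE Ed fE]] := Lf _ d20; have [F [mF Fd gF]] := Lg _ d20.
exists (E `|` F); split; first exact: measurableU.
  rewrite (le_lt_trans (measureU2 _ mE mF))//.
  by rewrite (splitr delta) EFinD lteD.
have fEF : (fun x => f x * \1_(~` (E `|` F)) x)%R \in Lfun mu p%:E.
  apply: (Lfun_le _ fE); first by apply: mrestr => //; exact: measurableU.
  by apply: restr_le; apply: subsetC; exact: subsetUl.
have gEF : (fun x => g x * \1_(~` (E `|` F)) x)%R \in Lfun mu p%:E.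
  apply: (Lfun_le _ gF); first by apply: mrestr => //; exact: measurableU.
  by apply: restr_le; apply: subsetC; exact: subsetUr.
rewrite [X in X \in _](_ : _ =
  a *: (fun x => f x * \1_(~` (E `|` F)) x)%R +
  (fun x => g x * \1_(~` (E `|` F)) x))%R; first exact: LD.
apply/funext => x.
by rewrite -[RHS]/(a * (f x * _) + g x * _)%R mulrDl mulrA.
Qed.

Let mmin f : measurable_fun setT f ->
  measurable_fun setT (fun x => minr `|f x| 1)%R.
Proof. by move=> mf; apply: measurable_minr => //; exact: measurableT_comp. Qed.

Let min0 (r : R) : (0 <= minr `|r| 1)%R.
Proof. by rewrite le_min normr_ge0/=. Qed.

Lemma alpha_normD f g : measurable_fun setT f -> measurable_fun setT g ->
  alpha_norm (f \+ g)%R <= alpha_norm f + alpha_norm g.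
Proof.
move=> mf mg; apply: (@le_trans _ _
  (Lnorm mu p%:E (EFin \o
    ((fun x => minr `|f x| 1) \+ (fun x => minr `|g x| 1))%R))).
  apply: le_Lnorm; [|apply: measurable_funD|move=> x].
  - by apply: mmin; exact: measurable_funD.
  - exact: mmin.
  - exact: mmin.
  rewrite (ger0_norm (min0 _)) (ger0_norm (addr_ge0 (min0 _) (min0 _))) ge_min.
  have /= := ler_normD (f x) (g x); rewrite /=; move: (f x) (g x) => a b ab.
  rewrite minEle; case: ifPn => _; rewrite minEle; case: ifPn => _.
  - by rewrite ab.
  - by rewrite lerDr normr_ge0 orbT.
  - by rewrite lerDl normr_ge0 orbT.
  - by rewrite lerDl ler01 orbT.
by apply: eminkowski => //; exact: mmin.
Qed.

Lemma alpha_norm_fin f : in_Lambda f -> alpha_norm f \is a fin_num.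
Proof.
move=> [mf Lf]; rewrite ge0_fin_numE ?Lnorm_ge0//.
have [E [mE E1 fE]] := Lf _ ltr01.
have : (fun x => minr `|f x| 1)%R \in Lfun mu p%:E; last first.
  by move=> /andP[_]; rewrite inE.
have E1' : \1_E \in Lfun mu p%:E.
  apply/andP; rewrite !inE/=; split; first exact/measurable_indicP.
  apply: (@lty_poweRy _ _ p); first by rewrite gt_eqF.
  rewrite poweR_Lnorm ?gt_eqF//.
  rewrite (eq_integral (fun x => (\1_E x)%:E)); last first.
    move=> x _; rewrite /= indicE.
    by case: (x \in E); rewrite ?normr1 ?normr0 ?powR1 ?powR0// gt_eqF.
  by rewrite integral_indic// setIT (lt_trans E1)// ltry.
have fE' : (fun x => `|f x * \1_(~` E) x|)%R \in Lfun mu p%:E.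
  apply: (Lfun_le _ fE); first by apply: measurableT_comp => //; exact: mrestr.
  by move=> x; rewrite normr_id.
have [L0 LD] := Lfun_submod_closed mu p1E.
apply: (Lfun_le _ (LD 1%R _ _ E1' fE')); first exact: mmin.
move=> x; rewrite (ger0_norm (min0 _))//= scale1r.
rewrite [X in (_ <= `|X|)%R](_ : _ = \1_E x + `|f x * \1_(~` E) x|)%R//.
rewrite [leRHS]ger0_norm ?addr_ge0// !indicE in_setC ge_min.
by case: (x \in E); rewrite /= ?mulr0 ?mulr1 ?normr0 ?addr0 ?add0r ?lexx ?orbT.
Qed.

Lemma alpha_normN f : alpha_norm (fun x => - f x)%R = alpha_norm f.
Proof. by apply: eq_Lnorm => x /=; rewrite normrN. Qed.

Lemma alpha_norm_ae_eq f g :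
  measurable_fun setT f -> measurable_fun setT g ->
  {ae mu, forall x, f x = g x} -> alpha_norm f = alpha_norm g.
Proof.
move=> mf mg fg; rewrite /alpha_norm unlock /Lnorm; congr (_ `^ _).
apply: ae_eq_integral => //.
- apply: (measurableT_comp (measurable_poweR _)).
  by apply: measurableT_comp => //; exact/measurable_EFinP/mmin.
- apply: (measurableT_comp (measurable_poweR _)).
  by apply: measurableT_comp => //; exact/measurable_EFinP/mmin.
by apply: filterS fg => x /= -> _.
Qed.

Lemma alpha_norm_eq0 f : measurable_fun setT f ->
  alpha_norm f = 0 <-> {ae mu, forall x, f x = 0%R}.
Proof.
move=> mf; split.
  have mE : measurable_fun setT (EFin \o (fun x => minr `|f x| 1)%R).
    exact/measurable_EFinP/mmin.
  have p0E : 0 < p%:E by rewrite lte_fin.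
  move=> /(Lnorm_eq0_eq0 mE p0E); apply: filterS => x /= /(_ I) [] /eqP.
  by rewrite minEle; case: ifPn => _; rewrite ?oner_eq0 // normr_eq0 => /eqP.
move=> f0; rewrite (@alpha_norm_ae_eq f (cst 0%R))//.
rewrite /alpha_norm (_ : (fun _ => _) = cst 0) ?Lnorm0// ?eqe ?gt_eqF//.
by apply/funext => x; rewrite normr0 minEle ler01.
Qed.

End alpha_norm.

Section Lambda_fun.
Context d (T : measurableType d) (R : realType).
Variables (mu : {measure set T -> \bar R}) (p : R).

(* The bound 1 <= p plays no role in the predicate; it is recorded so that
   closure under sums (Minkowski) can be attached to it. *)
Definition Lambda_pred & 1 <= p : {pred T -> R} :=
  fun f => `[< in_Lambda mu p f >].

Variable p1 : 1 <= p.

Fact Lambda_pred_submod_closed : submod_closed (Lambda_pred p1).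
Proof.
have [L0 LD] := in_Lambda_submod_closed mu p1.
split=> [|a f g /asboolP fL /asboolP gL]; apply/asboolP; first exact: L0.
exact: LD.
Qed.

HB.instance Definition _ :=
  GRing.isSubmodClosed.Build R (T -> R) (Lambda_pred p1)
    Lambda_pred_submod_closed.

Record Lambda_fun := MkLambdaFun {
  Lambda_val :> T -> R ;
  Lambda_valP : Lambda_val \in Lambda_pred p1 }.

HB.instance Definition _ := [isSub for Lambda_val].
HB.instance Definition _ := [Choice of Lambda_fun by <:].
HB.instance Definition _ := [SubChoice_isSubLmodule of Lambda_fun by <:].

Lemma Lambda_funP (f : Lambda_fun) : in_Lambda mu p f.
Proof. exact/asboolP/Lambda_valP. Qed.

Definition ae_null : {pred Lambda_fun} :=
  fun f => `[< {ae mu, forall x, f x = 0} >].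

Fact ae_null_submod_closed : submod_closed ae_null.
Proof.
split=> [|a f g /asboolP f0 /asboolP g0]; apply/asboolP; first exact: aeW.
apply: filterS2 f0 g0 => x /= fx gx.
by rewrite -[LHS]/(a * f x + g x) fx gx mulr0 addr0.
Qed.

HB.instance Definition _ :=
  GRing.isSubmodClosed.Build R Lambda_fun ae_null ae_null_submod_closed.

Local Open Scope quotient_scope.

(* Functions identified a.e. (see Lambda_eqP) *)
Definition Lambda := Quotient.quot ae_null.
HB.instance Definition _ := GRing.Zmodule.on Lambda.
HB.instance Definition _ := EqQuotient.on Lambda.

Lemma Lambda_eqP (f g : Lambda_fun) :
  \pi_Lambda f = \pi_Lambda g <-> {ae mu, forall x, f x = g x}.
Proof.
have -> : (\pi_Lambda f = \pi_Lambda g) <-> f - g \in ae_null.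
  rewrite Quotient.idealrBE; split=> /eqP//.
rewrite unfold_in asboolE; split; apply: filterS => x.
  by move/eqP; rewrite subr_eq0 => /eqP.
by move=> fgx; rewrite -[LHS]/(f x - g x) fgx subrr.
Qed.

Lemma Lambda_ind (P : Lambda -> Prop) :
  (forall f : Lambda_fun, P (\pi_Lambda f)) -> forall x, P x.
Proof. by move=> Pf x; rewrite -[x]reprK. Qed.

Definition Lambda_scale (a : R) (x : Lambda) : Lambda :=
  \pi_Lambda (a *: repr x).

Lemma pi_Lambda_scale a (f : Lambda_fun) :
  Lambda_scale a (\pi_Lambda f) = \pi_Lambda (a *: f).
Proof.
apply/Lambda_eqP.
have /Lambda_eqP : \pi_Lambda (repr (\pi_Lambda f)) = \pi_Lambda f.
  exact: reprK.
apply: filterS => x fx.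
by rewrite -[LHS]/(a * repr (\pi_Lambda f) x) fx.
Qed.

Lemma pi_LambdaD (f g : Lambda_fun) :
  \pi_Lambda f + \pi_Lambda g = \pi_Lambda (f + g) :> Lambda.
Proof. exact/esym/(Quotient.pi_add ae_null f g). Qed.

Fact Lambda_scaleA a b (x : Lambda) :
  Lambda_scale a (Lambda_scale b x) = Lambda_scale (a * b) x.
Proof.
by elim/Lambda_ind: x => f; rewrite !pi_Lambda_scale scalerA.
Qed.

Fact Lambda_scale1 : left_id 1 Lambda_scale.
Proof. by elim/Lambda_ind => f; rewrite pi_Lambda_scale scale1r. Qed.

Fact Lambda_scaleDr : right_distributive Lambda_scale +%R.
Proof.
move=> a; elim/Lambda_ind => f; elim/Lambda_ind => g.
by rewrite pi_LambdaD !pi_Lambda_scale pi_LambdaD scalerDr.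
Qed.

Fact Lambda_scaleDl x : {morph Lambda_scale^~ x : a b / a + b}.
Proof.
move=> a b /=; elim/Lambda_ind: x => f.
by rewrite !pi_Lambda_scale pi_LambdaD scalerDl.
Qed.

HB.instance Definition _ := GRing.Zmodule_isLmodule.Build R Lambda
  Lambda_scaleA Lambda_scale1 Lambda_scaleDr Lambda_scaleDl.

Definition Lambda_dist (x y : Lambda) : R :=
  fine (alpha_norm mu p (repr x - repr y)).

Let alpha_fin (f : Lambda_fun) : alpha_norm mu p f \is a fin_num.
Proof. by apply: alpha_norm_fin => //; exact: Lambda_funP. Qed.

Let m (f : Lambda_fun) : measurable_fun [set: T] f.
Proof. by have [] := Lambda_funP f. Qed.

Let mB (f g : Lambda_fun) : measurable_fun [set: T] (f - g : T -> R).
Proof. exact: (m (f - g)). Qed.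

Lemma Lambda_distE (f g : Lambda_fun) :
  Lambda_dist (\pi_Lambda f) (\pi_Lambda g) = fine (alpha_norm mu p (f - g)).
Proof.
congr fine; apply: alpha_norm_ae_eq => //.
have [/Lambda_eqP ff /Lambda_eqP gg] :
    \pi_Lambda (repr (\pi_Lambda f)) = \pi_Lambda f /\
    \pi_Lambda (repr (\pi_Lambda g)) = \pi_Lambda g by rewrite !reprK.
apply: filterS2 ff gg => x fx gx.
by rewrite -[LHS]/(repr (\pi_Lambda f) x - repr (\pi_Lambda g) x) fx gx.
Qed.

Fact Lambda_distxx x : Lambda_dist x x = 0.
Proof.
rewrite /Lambda_dist (alpha_norm_eq0 mu p1 (mB _ _)).2//.
by apply: aeW => t; exact: subrr.
Qed.

Fact Lambda_dist_eq0 x y : Lambda_dist x y = 0 -> x = y.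
Proof.
elim/Lambda_ind: x => f; elim/Lambda_ind: y => g; rewrite Lambda_distE => fg.
apply/Lambda_eqP.
have : alpha_norm mu p (f - g) = 0%E.
  by rewrite -[LHS]fineK ?fg//; exact: (alpha_fin (f - g)).
move=> /(alpha_norm_eq0 mu p1 (mB _ _)); apply: filterS => t.
by move/eqP; rewrite subr_eq0 => /eqP.
Qed.

Fact Lambda_dist_sym x y : Lambda_dist x y = Lambda_dist y x.
Proof.
rewrite /Lambda_dist -alpha_normN; congr (fine (alpha_norm _ _ _)).
by apply/funext => t; exact: opprB.
Qed.

Fact Lambda_dist_triangle y x z :
  Lambda_dist x z <= Lambda_dist x y + Lambda_dist y z.
Proof.
pose f := repr x; pose g := repr y; pose h := repr z.
rewrite /Lambda_dist -fineD;
  [|exact: (alpha_fin (f - g))|exact: (alpha_fin (g - h))].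
rewrite fine_le ?fin_numD ?(alpha_fin (f - g)) ?(alpha_fin (g - h))
  ?(alpha_fin (f - h))//.
have -> : Lambda_val (f - h) = Lambda_val (f - g) \+ Lambda_val (g - h).
  by apply/funext => t; rewrite -[RHS]/((f t - g t) + (g t - h t)) addrA subrK.
by apply: alpha_normD => //; exact: m.
Qed.

HB.instance Definition _ := @isMetric.Build R Lambda Lambda_dist
  Lambda_distxx Lambda_dist_eq0 Lambda_dist_sym Lambda_dist_triangle.

End Lambda_fun.

Definition topological_dual (R : numFieldType)
    (E : preTopologicalLmodType R) : set (E -> R^o) :=
  [set F | linear F /\ continuous F].
Arguments topological_dual {R} E.

Section lebesgue_tuple_succ.
Context (R : realType) (n : nat).
Local Notation mR := (measurableTypeR R).
Variable m : {sigma_finite_measure set (n.-tuple mR) -> \bar R}.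

Definition tuple_cons (x : mR * n.-tuple mR) : n.+1.-tuple mR :=
  [tuple of x.1 :: x.2].

Fact measurable_tuple_cons : measurable_fun [set: mR * n.-tuple mR] tuple_cons.
Proof. by apply: measurable_cons. Qed.

HB.instance Definition _ :=
  isMeasurableFun.Build _ _ _ _ tuple_cons measurable_tuple_cons.

Definition lebesgue_tuple_succ : set (n.+1.-tuple mR) -> \bar R :=
  pushforward (lebesgue_measure \x m)%E tuple_cons.

Let mu0 : lebesgue_tuple_succ set0 = 0%E.
Proof. exact: measure0. Qed.

Let mu_ge0 A : (0 <= lebesgue_tuple_succ A)%E.
Proof. exact: measure_ge0. Qed.

Let mu_sigma_additive : semi_sigma_additive lebesgue_tuple_succ.
Proof. exact: measure_semi_sigma_additive. Qed.

HB.instance Definition _ := isMeasure.Build _ _ _ lebesgue_tuple_succ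
  mu0 mu_ge0 mu_sigma_additive.

Let tuple_uncons (t : n.+1.-tuple mR) : mR * n.-tuple mR :=
  (tnth t ord0, [tuple of behead t]).

Let measurable_tuple_uncons : measurable_fun setT tuple_uncons.
Proof.
apply/measurable_fun_pairP; split.
  exact: measurable_tnth.
exact: measurable_behead.
Qed.

Let sigma_finite_succ : sigma_finite setT lebesgue_tuple_succ.
Proof.
have /sigma_finiteP[F [FT ndF Foo]] := sigma_finiteT (@lebesgue_measure R).
have /sigma_finiteP[G [GT ndG Goo]] := sigma_finiteT m.
exists (fun k => tuple_uncons @^-1` (F k `*` G k)).
  apply/seteqP; split=> // t _.
  have [i _ Fi] : (\bigcup_i F i) (tuple_uncons t).1 by rewrite -FT.
  have [j _ Gj] : (\bigcup_j G j) (tuple_uncons t).2 by rewrite -GT.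
  exists (maxn i j) => //; split.
    by move: Fi; apply/subsetPset/ndF/leq_maxl.
  by move: Gj; apply/subsetPset/ndG/leq_maxr.
move=> k; have [mF Fk] := Foo k; have [mG Gk] := Goo k; split.
  rewrite -[X in measurable X]setTI; apply: measurable_tuple_uncons => //.
  exact: measurableX.
rewrite /lebesgue_tuple_succ /pushforward -comp_preimage.
rewrite (_ : tuple_uncons \o tuple_cons = id).
  rewrite preimage_id product_measure1E//.
  by rewrite lte_mul_pinfty// ge0_fin_numE.
apply/funext => -[x t]; rewrite /= /tuple_uncons /tuple_cons /=; congr pair.
exact: val_inj.
Qed.

HB.instance Definition _ := Measure_isSigmaFinite.Build _ _ _
  lebesgue_tuple_succ sigma_finite_succ.

End lebesgue_tuple_succ.

Fixpoint lebesgue_tuple (R : realType) (n : nat) :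
    {sigma_finite_measure set (n.-tuple (measurableTypeR R)) -> \bar R} :=
  match n with
  | 0 => \d_ [tuple]
  | n'.+1 => lebesgue_tuple_succ (lebesgue_tuple R n')
  end.

Section euclidean.
Context (R : realType) (n : nat).
Local Notation mR := (measurableTypeR R).

(* R^n with its topology and the Borel sigma-algebra generated by it *)
Definition euclidean := g_sigma_algebraType (@open 'rV[R]_n).
HB.instance Definition _ := Measurable.on euclidean.

Definition tuple_euclidean (t : n.-tuple mR) : euclidean :=
  \row_i tnth t i.

Fact measurable_tuple_euclidean :
  measurable_fun [set: n.-tuple mR] tuple_euclidean.
Proof.
apply: measurability => // _ [U oU <-]; rewrite setTI.
pose B (qk : 'rV[rat]_n * nat) : set (n.-tuple mR) :=
  \bigcap_(i in [set: 'I_n])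
    (@tnth n mR ^~ i) @^-1` ball (ratr (qk.1 ord0 i) : R) (qk.2.+1%:R^-1 : R).
rewrite (_ : _ @^-1` _ = \bigcup_qk
    (if `[< B qk `<=` tuple_euclidean @^-1` U >] then B qk else set0)).
  apply: countable_bigcupT_measurable; first exact: countableP.
  move=> qk; case: ifP => // _.
  apply: fin_bigcap_measurable => // i _.
  rewrite -[X in measurable X]setTI; apply: measurable_tnth => //.
  exact: measurable_ball.
apply/seteqP; split=> [t /= Ut|t [qk _]]; last first.
  by case: asboolP => // + Bt; exact.
have /nbhs_ballP[e /= e0 eU] := open_nbhs_nbhs (conj oU Ut).
have [k ke] : exists k : nat, k.+1%:R^-1 < e / 2.
  have [k _ /(_ k (leqnn k))] :=
    near_infty_natSinv_lt (PosNum (divr_gt0 e0 (ltr0n R 2))).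
  by exists k.
have k0 : 0 < k.+1%:R^-1 :> R by rewrite invr_gt0.
have /choice[q qt] : forall i : 'I_n, exists r : rat,
    `|tnth t i - ratr r| < k.+1%:R^-1.
  move=> i.
  have /rat_in_itvoo[r] : tnth t i - k.+1%:R^-1 < tnth t i + k.+1%:R^-1.
    by rewrite ltrD2l gt0_cp.
  rewrite in_itv/= => /andP[? ?]; exists r.
  by rewrite distrC ltr_distl; apply/andP.
exists (\row_i q i, k) => //; case: asboolP => [_|[]].
  by move=> i _; rewrite /= mxE /ball/= distrC.
move=> s Bs; apply: eU; split => // i j; rewrite !mxE /ball/=.
rewrite -(subrK (ratr (q j)) (tnth t j)) -addrA (le_lt_trans (ler_normD _ _))//.
rewrite [ltRHS]splitr ltrD// (lt_trans _ ke)//.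
by have := Bs j I; rewrite /= mxE.
Qed.

HB.instance Definition _ :=
  isMeasurableFun.Build _ _ _ _ tuple_euclidean measurable_tuple_euclidean.

(* The n-fold product of the one-dimensional Lebesgue measure, carried over from
   tuples to 'rV[R]_n; lebesgue_box computes it on boxes. *)
Definition lebesgue : set euclidean -> \bar R :=
  pushforward (lebesgue_tuple R n) tuple_euclidean.

Let mu0 : lebesgue set0 = 0%E.
Proof. exact: measure0. Qed.

Let mu_ge0 A : (0 <= lebesgue A)%E.
Proof. exact: measure_ge0. Qed.

Let mu_sigma_additive : semi_sigma_additive lebesgue.
Proof. exact: measure_semi_sigma_additive. Qed.

HB.instance Definition _ := isMeasure.Build _ _ _ lebesgue
  mu0 mu_ge0 mu_sigma_additive.

End euclidean.
Arguments lebesgue : clear implicits.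
Arguments lebesgue_tuple : clear implicits.

Lemma lebesgue_tuple_rect (R : realType) (n : nat)
    (A : 'I_n -> set (measurableTypeR R)) : (forall i, measurable (A i)) ->
  lebesgue_tuple R n [set t | forall i, A i (tnth t i)] =
  (\prod_(i < n) lebesgue_measure (A i))%E.
Proof.
elim: n A => [|n IHn] A mA.
  by rewrite big_ord0 /= diracE mem_set// => -[].
rewrite big_ord_recl -IHn// -product_measure1E//; last first.
  rewrite (_ : mkset _ =
      \bigcap_(i in [set: 'I_n]) (@tnth n _ ^~ i) @^-1` A (lift ord0 i)).
    apply: fin_bigcap_measurable => // i _.
    by rewrite -[X in measurable X]setTI; exact: measurable_tnth.
  by apply/seteqP; split=> [t At i _|t At i]; exact: At.
rewrite /= /lebesgue_tuple_succ /pushforward; congr (product_measure1 _ _ _).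
apply/seteqP; split=> [[x t] /= At|[x t] /= [Ax At] i].
  split=> [|i]; first by have := At ord0.
  by have := At (lift ord0 i); rewrite tnthS.
by case: (unliftP ord0 i) => [j|] ->; rewrite ?tnthS// tnth0.
Qed.

Lemma lebesgue_box (R : realType) (n : nat) (a b : 'I_n -> R) :
  (forall i, a i <= b i) ->
  lebesgue R n [set x : 'rV[R]_n | forall i, a i <= x ord0 i <= b i] =
  (\prod_(i < n) (b i - a i))%:E.
Proof.
move=> ab; pose A i : set (measurableTypeR R) := `[a i, b i]%classic.
rewrite /lebesgue /pushforward.
rewrite (_ : _ @^-1` _ = [set t | forall i, A i (tnth t i)]); last first.
  by apply/seteqP; split=> t /= At i; have := At i; rewrite /A /= mxE in_itv.
rewrite lebesgue_tuple_rect => [|i]; last exact: measurable_itv.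
rewrite -prodEFin; apply: eq_bigr => i _.
rewrite lebesgue_measure_itv/= lte_fin; case: ifPn => [_|].
  by rewrite EFinB.
by rewrite -leNgt => ba; rewrite (@le_anti _ _ (a i) (b i)) ?subrr ?ab.
Qed.

(* Main.v *)
(* Fix a continuous linear functional F, and e such that |F| < 1 on the ball of
   radius e. A function supported on a set of measure < e^p stays in this ball
   under all scalings, hence F kills it. Cover the space by countably many sets
   of measure < e^p: removing finitely many of them from the support of f does
   not change F f, and what remains eventually has alpha-norm < e by dominated
   convergence. So |F f| < 1 for every f, and F = 0 by homogeneity. *)
Require Import Defs.
From mathcomp Require Import all_boot all_order all_algebra.
From mathcomp Require Import all_classical all_reals all_analysis measurable_realfun.
Set Implicit Arguments.
Unset Strict Implicit.
Import Order.TTheory GRing.Theory Num.Theory.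
Import numFieldTopology.Exports numFieldNormedType.Exports.
Local Open Scope classical_set_scope.
Local Open Scope ring_scope.

Section small_cover.
Context d (T : measurableType d) (R : realType).
Variables (mu : {measure set T -> \bar R}) (p : R) (p1 : 1 <= p).
Local Open Scope quotient_scope.

Let p0 : 0 < p. Proof. exact: lt_le_trans ltr01 p1. Qed.

Definition restrict (f : T -> R) (A : set T) (x : T) : R := f x * \1_A x.

(** An exceptional set for [f] also serves its restriction, since multiplying by an indicator does
    not increase absolute values. *)
Lemma in_Lambda_restrict (f : T -> R) (A : set T) :
  measurable A -> in_Lambda mu p f -> in_Lambda mu p (restrict f A).
Proof.
move=> mA [mf Lf].
have mfA : measurable_fun setT (restrict f A).
  by apply: measurable_funM => //; exact/measurable_indicP.
split=> // e /Lf[E [mE Ee fE]]; exists E; split=> //.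
apply: (Lfun_le p1 _ fE) => [|x].
  by apply: measurable_funM => //; exact/measurable_indicP/measurableC.
rewrite /restrict mulrAC normrM ler_piMr// indicE.
by case: (_ \in _); rewrite ?normr1 ?normr0.
Qed.

Definition Lambda_restrict (f : Lambda_fun mu p1) A (mA : measurable A) :
    Lambda_fun mu p1 :=
  MkLambdaFun (asboolT (in_Lambda_restrict mA (Lambda_funP f))).

(** The integrand behind [alpha_norm]; working with its integral avoids the [p]-th root. *)
Definition trunc_pow (f : T -> R) (x : T) : \bar R :=
  ((Num.min `|f x| 1) `^ p)%:E.

Lemma measurable_trunc_pow f : measurable_fun setT f ->
  measurable_fun setT (trunc_pow f).
Proof.
move=> mf; apply/measurable_EFinP.
apply: (measurableT_comp (measurable_powR _)).
by apply: measurable_minr => //; exact: measurableT_comp.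
Qed.

Lemma alpha_normE f :
  (alpha_norm mu p f `^ p = \int[mu]_x trunc_pow f x)%E.
Proof.
rewrite /alpha_norm poweR_Lnorm; last exact: lt0r_neq0.
apply: eq_integral => x _ /=.
by rewrite ger0_norm// le_min normr_ge0 ler01.
Qed.

(** Monotonicity of [p]-th powers. Membership in the space makes the norm finite, so [fine] cannot
    turn an infinite norm into 0. *)
Lemma alpha_norm_lt (e : R) f : 0 < e -> in_Lambda mu p f ->
  (\int[mu]_x trunc_pow f x < (e `^ p)%:E)%E -> fine (alpha_norm mu p f) < e.
Proof.
move=> e0 Lf; have /fineK fE := alpha_norm_fin p1 Lf.
rewrite -alpha_normE -fE poweR_EFin lte_fin => fe; rewrite ltNge.
apply: contraTN fe => ef; rewrite -leNgt.
apply: ge0_ler_powR => //; rewrite ?nnegrE ?(ltW p0) ?(ltW e0)//.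
exact: le_trans (ltW e0) ef.
Qed.

Lemma trunc_pow_restrict f A x :
  trunc_pow (restrict f A) x = (trunc_pow f x * (\1_A x)%:E)%E.
Proof.
rewrite /trunc_pow /restrict indicE; case: (_ \in _); rewrite ?mulr1 ?mule1//.
by rewrite mulr0 normr0 mule0 minEle ler01 powR0// gt_eqF.
Qed.

Lemma trunc_pow_le1 f x : (trunc_pow f x <= 1)%E.
Proof.
have -> : 1%E = (1 `^ p)%:E :> \bar R by rewrite powR1.
rewrite lee_fin.
apply: ge0_ler_powR; rewrite ?nnegrE ?(ltW p0) ?le_min ?ler01 ?normr_ge0//.
Qed.

(** The truncated power of the restriction is at most the indicator of [A], so its integral is at
    most [mu A]. This bound does not depend on [f], hence it survives every scaling of [f]. *)
Lemma alpha_norm_restrict_lt (e : R) (f : Lambda_fun mu p1) A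
    (mA : measurable A) : 0 < e -> (mu A < (e `^ p)%:E)%E ->
  fine (alpha_norm mu p (Lambda_restrict f mA)) < e.
Proof.
move=> e0 Ae; apply: alpha_norm_lt => //; first exact: Lambda_funP.
apply: le_lt_trans Ae.
have -> : (mu A = \int[mu]_x (\1_A x)%:E)%E by rewrite integral_indic// setIT.
apply: ge0_le_integral => // [x _|||x _]; first by rewrite lee_fin powR_ge0.
- by apply: measurable_trunc_pow; have [] := Lambda_funP (Lambda_restrict f mA).
- by apply/measurable_EFinP; exact/measurable_indicP.
rewrite trunc_pow_restrict -[leRHS]mul1e.
by rewrite lee_pmul ?trunc_pow_le1// lee_fin powR_ge0.
Qed.

Lemma alpha_norm_tail (f : Lambda_fun mu p1) (A : nat -> set T)
    (mA : forall n, measurable (A n)) (e : R) : 0 < e ->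
  nonincreasing_seq A -> \bigcap_n A n = set0 ->
  exists n, fine (alpha_norm mu p (Lambda_restrict f (mA n))) < e.
Proof.
move=> e0 ndA A0.
have mt n := measurable_trunc_pow (Lambda_funP (Lambda_restrict f (mA n))).1.
have [mf Lf] := Lambda_funP f.
have tge0 g x : (0 <= trunc_pow g x)%E by rewrite lee_fin powR_ge0.
have int : mu.-integrable setT (trunc_pow f).
  apply/integrableP; split; first exact: measurable_trunc_pow.
  under eq_integral do rewrite gee0_abs//.
  rewrite -alpha_normE.
  by rewrite -(fineK (alpha_norm_fin p1 (Lambda_funP f))) poweR_EFin ltry.
(* The dominating function is [trunc_pow f], integrable because the norm of [f] is finite. At each
   point the sequence is eventually 0, as the point leaves some [A n] and never returns. *)
have [|||_ _] := @dominated_convergence _ _ _ mu _ measurableT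
    (fun n => trunc_pow (Lambda_restrict f (mA n))) (cst 0%E) (trunc_pow f)
    mt _ _ int.
- exact: measurable_cst.
- apply: aeW => x _ /=.
  have [n nAx] : exists n, ~ A n x.
    by apply/existsNP => Ax; have : (\bigcap_n A n) x by []; rewrite A0.
  apply: cvg_near_cst; exists n => // m /= nm.
  rewrite trunc_pow_restrict indicE memNset ?mule0// => Amx; apply: nAx.
  by move: Amx; apply/subsetPset/ndA.
- apply: aeW => x n _; rewrite gee0_abs // trunc_pow_restrict.
  by rewrite -[leRHS]mule1 lee_pmul// lee_fin// indicE lern1 leq_b1.
rewrite integral0.
move=> /(_ [set y | (y < (e `^ p)%:E)%E])[|n _ /(_ n (leqnn n)) ne].
  apply: open_nbhs_nbhs; split; first exact: open_ereal_lt_ereal.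
  by rewrite /= lte_fin powR_gt0.
by exists n; apply: alpha_norm_lt => //; exact: Lambda_funP.
Qed.

Context (F : Lambda mu p1 -> R^o) (lF : linear F) (cF : continuous F).
Local Notation "[ f ]_L" := (\pi_(Lambda mu p1) f) (format "[ f ]_L").

Let F0 : F 0 = 0.
Proof. by have := lF (-1) 0 0; rewrite !scaleN1r !addNr. Qed.

Let FZ a x : F (a *: x) = a * F x.
Proof. by have := lF a x 0; rewrite !addr0 F0 addr0. Qed.

Lemma Lambda_functional_bounded :
  exists2 e : R, 0 < e & forall f : Lambda_fun mu p1,
    fine (alpha_norm mu p f) < e -> `|F [f]_L| < 1.
Proof.
have /cvgrPdist_lt/(_ 1 ltr01) := cF (x := 0).
rewrite F0 => /nbhs_ballP[e /= e0 He]; exists e => // f fe.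
rewrite -normrN -sub0r; apply: He.
rewrite ballEmdist /= metric_sym.
(* Writing 0 as the class of the zero function lets the distance be computed on representatives. *)
have -> : 0 = [0]_L :> Lambda mu p1.
  by rewrite -[LHS](scale0r [0]_L) [LHS]pi_Lambda_scale scaler0.
by rewrite [mdist _ _]Lambda_distE subr0.
Qed.

(** If [F x] were nonzero, scaling [x] by its inverse would give the value 1. *)
Lemma Lambda_functional_eq0 x : (forall a, `|F (a *: x)| < 1) -> F x = 0.
Proof.
move=> Fx; apply/eqP; apply: contraT => Fx0.
by have := Fx (F x)^-1; rewrite FZ mulVf// normr1 ltxx.
Qed.

Lemma pi_Lambda_restrictZ a f A (mA : measurable A) :
  a *: [Lambda_restrict f mA]_L = [Lambda_restrict (a *: f) mA]_L.
Proof.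
rewrite [LHS]pi_Lambda_scale; apply/Lambda_eqP/aeW => x.
exact: mulrA.
Qed.

(** Isolates the one property of Lebesgue measure that the argument uses: countable covers by sets
    of arbitrarily small measure. *)
Lemma Lambda_functional_small_cover :
  (forall e : R, 0 < e -> exists A : nat -> set T,
     (forall n, measurable (A n) /\ (mu (A n) < e%:E)%E) /\
     \bigcup_n A n = setT) ->
  F = cst 0.
Proof.
move=> cover.
have [e e0 Fe] := Lambda_functional_bounded.
have [A [mAe AT]] := cover _ (powR_gt0 p e0).
have mA n := (mAe n).1.
have Fsmall f B (mB : measurable B) : (mu B < (e `^ p)%:E)%E ->
    F [Lambda_restrict f mB]_L = 0.
  move=> Be; apply: Lambda_functional_eq0 => a.
  by rewrite pi_Lambda_restrictZ; apply: Fe; exact: alpha_norm_restrict_lt.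
(* What is left once the first [n] sets are removed; [C 0] is the whole space. *)
pose C n := ~` \big[setU/set0]_(k < n) A k.
have mC n : measurable (C n) by apply: measurableC; exact: bigsetU_measurable.
have ndC : nonincreasing_seq C.
  by move=> m n mn; apply/subsetPset/subsetC; exact: subset_bigsetU.
have C0 : \bigcap_n C n = set0.
  rewrite -subset0 => x Cx; have [k _ Akx] : (\bigcup_n A n) x by rewrite AT.
  by apply: (Cx k.+1 I); rewrite big_ord_recr /=; right.
(* [C n] splits into [C n.+1] and its part inside [A n]. The latter is no larger than [A n], so
   [Fsmall] applies to it. *)
have FC f n : F [f]_L = F [Lambda_restrict f (mC n)]_L.
  elim: n => [|n ->].
    congr (F _); apply/Lambda_eqP/aeW => x /=.
    by rewrite /C /restrict big_ord0 setC0 indicT mulr1.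
  have mAC : measurable (A n `&` C n) by exact: measurableI.
  rewrite -[RHS]addr0 -(Fsmall f _ mAC); last first.
    apply: le_lt_trans (mAe n).2; apply: le_measure; rewrite ?inE//.
  have := lF 1 [Lambda_restrict f (mC n.+1)]_L [Lambda_restrict f mAC]_L.
  rewrite !scale1r => <-; congr (F _); rewrite pi_LambdaD.
  apply/Lambda_eqP/aeW => x.
  rewrite -[RHS]/(f x * \1_(C n.+1) x + f x * \1_(A n `&` C n) x) -mulrDr.
  rewrite /= /restrict; congr (_ * _).
  have -> : C n.+1 = C n `&` ~` A n by rewrite /C big_ord_recr /= setCU.
  rewrite !indicE !in_setI in_setC.
  by case: (x \in A n); rewrite /= ?andbT ?andbF ?addr0 ?add0r.
apply/funext; elim/Lambda_ind => f; apply: Lambda_functional_eq0 => a.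
rewrite [_ *: _]pi_Lambda_scale.
(* This [n] depends on [a] and [f], which is harmless because [FC] holds for every [n]. *)
have [n fn] := alpha_norm_tail (a *: f) mC e0 ndC C0.
by rewrite (FC _ n); exact: Fe.
Qed.
End small_cover.

(** The cover consists of the closed cubes of a grid of mesh [1/(N+1)]. In dimension 0 it would
    fail: the space is then a point of mass 1. *)
Lemma lebesgue_lattice_cover (R : realType) (d : nat) (e : R) :
  (0 < d)%N -> 0 < e ->
  exists A : nat -> set (euclidean R d),
    (forall n, measurable (A n) /\ (lebesgue R d (A n) < e%:E)%E) /\
    \bigcup_n A n = setT.
Proof.
case: d => // d _ e0.
have [N Ne] : exists N : nat, N.+1%:R^-1 < e.
  have [k _ /(_ k (leqnn k))] := near_infty_natSinv_lt (PosNum e0).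
  by exists k.
have N0 : 0 < N.+1%:R :> R by [].
pose box (z : 'rV[int]_d.+1) : set (euclidean R d.+1) :=
  [set x : 'rV[R]_d.+1 | forall i,
    (z ord0 i)%:~R / N.+1%:R <= x ord0 i <=
    (z ord0 i)%:~R / N.+1%:R + N.+1%:R^-1].
have mbox z : measurable (box z).
  rewrite -[box z]setCK; apply: measurableC; apply: sub_sigma_algebra.
  apply: closed_openC.
  rewrite (_ : box z = \bigcap_(i in [set: 'I_d.+1])
    ((fun x : 'rV[R]_d.+1 => x ord0 i) @^-1`
      `[(z ord0 i)%:~R / N.+1%:R,
        (z ord0 i)%:~R / N.+1%:R + N.+1%:R^-1]%classic)); last first.
    apply/seteqP; split=> x /= xz i => [_|]; first by rewrite /= in_itv /= xz.
    by have := xz i I; rewrite /= in_itv.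
  apply: closed_bigI => i _.
  apply: preimage_closed; last exact: interval_closed.
  by move=> x _; exact: coord_continuous.
have box_lt z : (lebesgue R d.+1 (box z) < e%:E)%E.
  rewrite lebesgue_box => [|i]; last by rewrite lerDl invr_ge0.
  rewrite lte_fin; under eq_bigr do rewrite addrAC subrr add0r.
  (* One side length is split off and is below [e]; the other [d] factors are at most 1. *)
  rewrite big_ord_recl prodr_const card_ord.
  apply: le_lt_trans Ne; rewrite ler_piMr ?invr_ge0//.
  by rewrite exprn_ile1 ?invr_ge0// invf_le1// ler1n.
(* The integer vectors are enumerated by their codes; a number that codes none gets the empty
   set. *)
exists (fun n => if unpickle n is Some z then box z else set0); split=> [n|].
  by case: (unpickle n) => //; rewrite measure0 lte_fin.
apply/seteqP; split=> // x _.
(* The cube containing [x] has as lower corner the rounding down of [x] to the grid. *)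
exists (pickle (\row_i Num.floor (x ord0 i * N.+1%:R) : 'rV[int]_d.+1)) => //.
rewrite pickleK => i; rewrite !mxE.
have /andP[fx xf] := floor_itv (x ord0 i * N.+1%:R).
rewrite ler_pdivrMr// fx /= -[X in _ + X]mul1r -mulrDl ler_pdivlMr//.
by rewrite ltW// -[1]/(1%:~R) -intrD.
Qed.

Theorem proposition7p3 (R : realType) (d : nat) (hd : (0 < d)%N)
    (p : R) (p1 : 1 <= p) :
  topological_dual (Lambda (lebesgue R d) p1) = [set cst 0].
Proof.
apply/seteqP; split=> [F [lF cF]|F ->] /=.
  apply: Lambda_functional_small_cover => // e e0.
  exact: lebesgue_lattice_cover.
split; last exact: cst_continuous.
by move=> a x y; rewrite scaler0 addr0.
Qed.
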